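(* Let $(X,f)$ be a dynamical system with a dense set of minimal points. If $(X,f)$ has the $\overline{d}$-shadowing property or the $\underline{d}$-shadowing property, then it is totally syndetically transitive.
   Context: $\mathbb{N}=\{1,2,\dots\}$, $\mathbb{N}_0=\mathbb{N}\cup\{0\}$. A dynamical system $(X,f)$ is a compact metric space $(X,d)$ together with a continuous map $f\colon X\to X$. A minimal set is a nonempty closed invariant set with no nonempty closed invariant proper subset; a minimal point is an element of a minimal set. A set $S\subset\mathbb{N}_0$ is syndetic if there is $k>0$ with $S\cap[i,i+k]\ne\emptyset$ for all $i\in\mathbb{N}_0$. $f$ is syndetically transitive if for all nonempty open $U,V\subset X$ the set $\{n\in\mathbb{N}_0: f^n(U)\cap V\neq\emptyset\}$ is syndetic, and totally syndetically transitive if $f^n$ is syndetically transitive for every $n\in\mathbb{N}$. For $A\subset\mathbb{N}_0$, $\overline{d}(A)=\limsup_{n\to\infty}\frac1n|A\cap\{0,\dots,n-1\}|$ and $\underline{d}(A)=\liminf_{n\to\infty}\frac1n|A\cap\{0,\dots,n-1\}|$. A sequence $\{x_i\}_{i=0}^\infty\subset X$ is a $\delta$-ergodic pseudo-orbit of $f$ if $\lim_{n\to\infty}\frac1n|\{0\le i<n: d(f(x_i),x_{i+1})\ge\delta\}|=0$. $(X,f)$ has the $\underline{d}$-shadowing property (resp. the $\overline{d}$-shadowing property) if for every $\varepsilon>0$ there is $\delta>0$ such that for every $\delta$-ergodic pseudo-orbit $\{x_i\}_{i=0}^\infty$ there is $z\in X$ with $\underline{d}(\{i\in\mathbb{N}_0: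 d(f^i(z),x_i)<\varepsilon\})>0$ (resp. $\overline{d}(\{i\in\mathbb{N}_0: d(f^i(z),x_i)<\varepsilon\})>1/2$). *)

(* Defs.v *)
From HB Require Import structures.
From mathcomp Require Import all_boot all_order all_algebra.
From mathcomp Require Import all_classical all_reals all_analysis.

Set Implicit Arguments.
Unset Strict Implicit.
Unset Printing Implicit Defensive.

Import Order.TTheory GRing.Theory Num.Theory.
Import numFieldTopology.Exports numFieldNormedType.Exports.

Local Open Scope classical_set_scope.
Local Open Scope ring_scope.

(* The term at n = 0 is 0 / 0 = 0; it is irrelevant to the limits below. *)
Definition frequency (R : realType) (A : set nat) (n : nat) : R :=
  #|[pred i : 'I_n | (i : nat) \in A]|%:R / n%:R.

Definition upper_density (R : realType) (A : set nat) : R :=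
  limn_sup (frequency R A).

Definition lower_density (R : realType) (A : set nat) : R :=
  limn_inf (frequency R A).

Definition syndetic (S : set nat) : Prop :=
  exists2 k : nat, (0 < k)%N &
    forall i : nat, S `&` [set j | (i <= j <= i + k)%N] !=set0.

Section Topological.
Context {X : topologicalType}.
Implicit Types (f : X -> X) (M U V : set X).

(* Invariance is forward invariance, f(M) included in M. *)
Definition closed_invariant f M : Prop :=
  [/\ M !=set0, closed M & f @` M `<=` M].

Definition minimal_set f M : Prop :=
  closed_invariant f M /\
  forall M', closed_invariant f M' -> M' `<=` M -> M' = M.

Definition minimal_point f : set X :=
  [set x | exists2 M, minimal_set f M & M x].

Definition hitting_times f U V : set nat :=
  [set n | (iter n f @` U) `&` V !=set0].

Definition syndetically_transitive f : Prop :=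
  forall U V, open U -> open V -> U !=set0 -> V !=set0 ->
    syndetic (hitting_times f U V).

Definition totally_syndetically_transitive f : Prop :=
  forall n : nat, (0 < n)%N -> syndetically_transitive (iter n f).

End Topological.

Section Shadowing.
Context {R : realType} {X : metricType R}.
Implicit Types (f : X -> X) (x : nat -> X).

Definition ergodic_pseudo_orbit f (delta : R) x : Prop :=
  frequency R [set i | delta <= mdist (f (x i)) (x i.+1)] @ \oo --> (0 : R).

Definition shadowing_times f (eps : R) x (z : X) : set nat :=
  [set i | mdist (iter i f z) (x i) < eps].

Definition lower_density_shadowing f : Prop :=
  forall eps : R, 0 < eps -> exists2 delta : R, 0 < delta &
    forall x, ergodic_pseudo_orbit f delta x ->
      exists z : X, 0 < lower_density R (shadowing_times f eps x z).

Definition upper_density_shadowing f : Prop :=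
  forall eps : R, 0 < eps -> exists2 delta : R, 0 < delta &
    forall x, ergodic_pseudo_orbit f delta x ->
      exists z : X, 1 / 2 < upper_density R (shadowing_times f eps x z).

End Shadowing.

(* Main.v *)
Require Import Defs.
From mathcomp Require Import all_boot all_order all_algebra.
From mathcomp Require Import all_classical all_reals all_analysis.
From mathcomp Require Import ring lra zify.
Import numFieldTopology.Exports numFieldNormedType.Exports.
Import Order.TTheory GRing.Theory Num.Theory.

Set Implicit Arguments.
Unset Strict Implicit.

Local Open Scope classical_set_scope.
Local Open Scope ring_scope.

(** Fix [m > 0] and nonempty open sets [U] and [V]. Density of minimal points
    does two jobs.

    First, for every nonempty open [W] there is a point [w] whose orbit under
    the [m]-th iterate of [f] is in [W] along a syndetic set of times
    ([syndetic_visits_iter]). As a consequence a single hit from [U] to [V]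
    under that iterate is enough: with [W] the part of [U] sent into [V] by the
    hit, any two visits of [w] to [W] produce another hit
    ([syndetic_hitting_times]). So only transitivity of the iterate is at
    stake.

    Second, such a point [w], taken for a slightly smaller open subset of [U],
    makes the orbit of [w] a trap: if at some time [i], however large, a point
    [z] is close to the orbit of [w], then uniform continuity keeps them close
    until the next visit of [w] at a multiple of [m], which happens after a
    bounded delay, so [z] itself enters [U] at a multiple of [m] soon after [i]
    ([orbit_forcing_visits]). Congruence modulo [m] thus never has to be
    arranged in the pseudo-orbit.

    It remains to find [z] that is close to the orbit of such a point for [U] at
    some time, and to the orbit of such a point for [V] much later. Follow the
    two orbits alternately, in longer and longer blocks. The switches have
    density zero, so this is an ergodic pseudo-orbit for every [delta], and
    shadowing provides [z] ([shadow_two_orbits]). The lengths of the blocks are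
    chosen so that a shadowing set cannot eventually avoid the blocks of one
    orbit. For upper density above [1/2], block [k] starts at [k ^ 2] and each
    orbit occupies exactly half of the time asymptotically. For positive lower
    density, block [k] starts at [k * k`!]: just before a block ends it fills
    almost all of the past, so the times spent on the other orbit have lower
    density zero. *)

(** * Minimal sets and syndetic visits *)

Section Minimality.
Context {X : topologicalType}.
Implicit Types (f : X -> X) (M N U V W : set X).

Lemma continuous_iter f n : continuous f -> continuous (iter n f).
Proof.
move=> cf; elim: n => [|n IHn] x; first exact: cvg_id.
by apply: (@continuous_comp _ _ _ (iter n f) f); [exact: IHn|exact: cf].
Qed.

Lemma open_preimage_iter f n U :
  continuous f -> open U -> open [set x | U (iter n f x)].
Proof.
by move=> cf oU; apply: open_comp => // x _; exact: continuous_iter.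
Qed.

Lemma iterM f m n x : iter n (iter m f) x = iter (m * n) f x.
Proof.
by elim: n => [|n IHn]; rewrite ?muln0// mulnS iterS IHn -iterD.
Qed.

Lemma closed_invariant_iter f M n :
  closed_invariant f M -> closed_invariant (iter n f) M.
Proof.
move=> [M0 cM fM]; split=> // _ [x Mx <-].
by elim: n => [//|n IHn]; rewrite iterS; apply: fM; exists (iter n f x).
Qed.

(** The points of [M] whose orbit avoids [W] form a closed invariant set, proper
    because [M] meets [W]; by minimality it is empty. *)
Lemma minimal_set_visits f M W x : continuous f -> minimal_set f M ->
  open W -> M `&` W !=set0 -> M x -> exists n, W (iter n f x).
Proof.
move=> cf [[M0 cM fM] Mmin] oW [y [My Wy]] Mx.
apply: contrapT => /forallNP avoid.
pose M' := M `&` \bigcap_(n in [set: nat]) ~` [set z | W (iter n f z)].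
have M'M : M' = M.
  apply: Mmin; last by move=> z [].
  split; first by exists x; split=> // n _; exact: avoid.
  - apply: closedI => //; apply: closed_bigI => n _.
    by rewrite closedC; exact: open_preimage_iter.
  - move=> _ [z [Mz zW] <-]; split; first by apply: fM; exists z.
    by move=> n _; rewrite /= -iterSr; exact: (zW n.+1).
by move: My; rewrite -M'M => -[_ /(_ 0%N I)].
Qed.

(** By compactness the waiting time before a visit to [W] is bounded uniformly
    over [M]; apply the bound to every point of the orbit of [x]. *)
Lemma minimal_set_syndetic f M W x : continuous f -> compact M ->
  minimal_set f M -> open W -> M `&` W !=set0 -> M x ->
  syndetic [set n | W (iter n f x)].
Proof.
move=> cf kM mM oW MW Mx.
have fMi n z : M z -> M (iter n f z).
  move=> Mz; have [_ _] := closed_invariant_iter n mM.1.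
  by apply; exists z.
have [k _ visit] : \forall k \near \oo,
    M `<=` [set z | exists2 n, (n <= k)%N & W (iter n f z)].
  move/compact_near_coveringP : kM; apply => z Mz.
  have [n Wn] := minimal_set_visits cf mM oW MW Mz.
  exists ([set z' | W (iter n f z')], [set k | (n <= k)%N]) => /=.
    split; last exact: nbhs_infty_ge.
    by apply: open_nbhs_nbhs; split=> //; exact: open_preimage_iter.
  by move=> [z' k] [/= Wz' nk]; exists n.
exists k.+1 => // i.
have [n nk Wn] := visit k.+1 (leqnSn k) _ (fMi i _ Mx).
exists (n + i)%N; split; first by rewrite /= iterD.
by rewrite /= leq_addl addnC leq_add2l.
Qed.

(** Zorn's lemma, applied to the complements of closed invariant sets that meet
    [M]: the union of a chain of them cannot cover [M], by compactness. *)
Lemma exists_minimal_subset f M : continuous f -> compact M ->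
  closed_invariant f M -> exists2 N, minimal_set f N & N `<=` M.
Proof.
move=> cf kM [M0 cM fM].
pose P : set (set X) :=
  [set A | [/\ open A, f @` (~` A) `<=` ~` A & ~ M `<=` A]].
have [|A [[oA fA MA] Amax]] := @Zorn_bigcup X P.
  move=> F FP totF; split.
  - by apply: bigcup_open => A /FP[].
  - move=> _ [x xF <-] [A FA Afx]; have [_ fA _] := FP _ FA.
    apply: (fA (f x)) => //; exists x => // Ax; apply: xF; by exists A.
  have [[A0 FA0]|F0] := pselect (exists A, F A); last first.
    by move: M0 => [x Mx] /(_ x Mx)[A FA]; case: F0; exists A.
  (* the traces on [M] of the closed sets of the chain are a filter base; a
     cluster point in [M] lies in all of them *)
  pose G := filter_from F (fun A => M `\` A).
  have FG : ProperFilter G.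
    apply: filter_from_proper.
      apply: filter_from_filter; first by exists A0.
      move=> A B FA FB; have [AB|BA] := totF _ _ FA FB.
        by exists B => // x [Mx Bx]; do 2!split=> //; move/AB.
      by exists A => // x [Mx Ax]; do 2!split=> //; move/BA.
    move=> A /FP[_ _ /existsNP[x /not_implyP[Mx Ax]]].
    by exists x.
  have [|p [Mp Gp]] := kM G FG; first by exists A0 => // x [].
  move=> /(_ p Mp)[A FA Ap]; have [oA _ _] := FP _ FA.
  have GA : G (M `\` A) by exists A.
  have [x [[_ nAx] Ax]] := Gp _ A GA (open_nbhs_nbhs (conj oA Ap)).
  exact: nAx.
exists (M `\` A); last by move=> x [].
have cN : closed_invariant f (M `\` A).
  split.
  - by move/existsNP : MA => [x /not_implyP[Mx Ax]]; exists x.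
  - by apply: closedI => //; rewrite closedC.
  - move=> _ [x [Mx Ax] <-]; split; first by apply: fM; exists x.
    by apply: fA; exists x.
split=> // N [[x Nx] cNN fN] NMA; apply/seteqP; split=> // y [My Ay].
apply: contrapT => Ny; apply: (Amax (~` N)).
  split; first by move=> z Az /NMA[].
  by move=> /(_ y Ny).
split; first by rewrite openC.
  by rewrite setCK.
by move=> /(_ x (NMA _ Nx).1).
Qed.

End Minimality.

Section Syndetic.
Context {X : topologicalType} (f : X -> X).
Hypotheses (kX : compact [set: X]) (cf : continuous f).
Hypothesis dmin : dense (minimal_point f).
Implicit Types U V W : set X.

(** A minimal set [M] of [f] meeting [W] need not be minimal for the [m]-th
    iterate, but it contains a set [N] that is. Some [f^k] sends a point [p] of
    [N] into [W], and the visits of [p] to the [f^k]-preimage of [W] are the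
    visits of [f^k p] to [W]. *)
Lemma syndetic_visits_iter m W : open W -> W !=set0 ->
  exists w, syndetic [set n | W (iter n (iter m f) w)].
Proof.
move=> oW W0; have [x [Wx [M mM Mx]]] := dmin W0 oW.
have kM : compact M by apply: subclosed_compact kX _ => //; case: mM => -[].
have [N mN NM] :=
  exists_minimal_subset (@continuous_iter _ f m cf) kM
    (closed_invariant_iter m mM.1).
have [[p Np] cN _] := mN.1.
have MW : M `&` W !=set0 by exists x.
have [k Wk] := minimal_set_visits cf mM oW MW (NM _ Np).
have kN : compact N by apply: subclosed_compact kX _.
exists (iter k f p).
have : syndetic [set n | W (iter k f (iter n (iter m f) p))].
  have oW' := @open_preimage_iter _ f k W cf oW.
  apply: (minimal_set_syndetic (@continuous_iter _ f m cf) kN mN oW' _ Np).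
  by exists p.
congr syndetic; apply/funext => n /=.
by rewrite !iterM -!iterD addnC.
Qed.

(** Given a hit of duration [n], the differences of visiting times of a point [w]
    to [W], shifted by [n], are again hitting times. *)
Lemma syndetic_hitting_times m U V : open U -> open V ->
  hitting_times (iter m f) U V !=set0 -> syndetic (hitting_times (iter m f) U V).
Proof.
move=> oU oV [n [_ [[x Ux <-] Vx]]].
pose W := U `&` [set y | V (iter n (iter m f) y)].
have oW : open W.
  by apply: openI => //; apply/open_preimage_iter => //; exact: continuous_iter.
have [|w [k k0 Wk]] := @syndetic_visits_iter m W oW; first by exists x.
have [i0 [[Ui0 _] _]] := Wk 0%N.
exists (k + i0 + n)%N; first by rewrite -addnA ltn_addr.
move=> i; have [j [[_ Vj] /andP[/= ij ji]]] := Wk (i + i0)%N.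
exists (n + (j - i0))%N; split; last first.
  rewrite /=; lia.
exists (iter (n + j) (iter m f) w); split; last by rewrite iterD.
exists (iter i0 (iter m f) w) => //.
rewrite -iterD -addnA subnK//; lia.
Qed.

End Syndetic.

(** * Counting and densities *)

Definition count_below (A : set nat) (n : nat) : nat :=
  (\sum_(i < n) ((i : nat) \in A))%N.

Lemma count_belowS A n :
  count_below A n.+1 = (count_below A n + (n \in A))%N.
Proof. by rewrite /count_below big_ord_recr. Qed.

Lemma count_below_le A n : (count_below A n <= n)%N.
Proof.
elim: n => [|n IHn]; first by rewrite /count_below big_ord0.
by rewrite count_belowS -[n.+1]addn1 leq_add ?leq_b1.
Qed.

Lemma count_below_sub (A B : set nat) N n : (forall i, (N <= i)%N -> A i -> B i) ->
  (count_below A n <= N + count_below B n)%N.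
Proof.
move=> AB; elim: n => [|n IHn]; first by rewrite /count_below !big_ord0.
have [nN|Nn] := ltnP n N.
  by rewrite (leq_trans (count_below_le _ _))// ltn_addr.
rewrite !count_belowS addnA leq_add//.
by have [/set_mem/(AB _ Nn)/mem_set ->|] := boolP (n \in A).
Qed.

Section Density.
Context {R : realType}.
Implicit Types A : set nat.

Lemma frequencyE A n : frequency R A n = (count_below A n)%:R / n%:R.
Proof.
rewrite /frequency /count_below -sum1_card; congr (_%:R / _).
by rewrite big_mkcond; apply: eq_bigr => i _; rewrite inE/=; case: ifP.
Qed.

Lemma frequency_ge0 A n : 0 <= frequency R A n.
Proof. by rewrite frequencyE divr_ge0. Qed.

Lemma frequency_le c A n : 0 <= c ->
  (count_below A n)%:R <= c * n%:R -> frequency R A n <= c.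
Proof.
move=> c0 cA; rewrite frequencyE; case: n cA => [|n] cA.
  by rewrite invr0 mulr0.
by rewrite ler_pdivrMr.
Qed.

Lemma bounded_frequency A : bounded_fun (frequency R A).
Proof.
exists 1; split; first exact: real1.
move=> c c1 n _; rewrite /= ger0_norm ?frequency_ge0//.
apply: (le_trans _ (ltW c1)).
by apply: frequency_le; rewrite ?mul1r ?ler_nat ?count_below_le.
Qed.

Lemma upper_density_le c A : 0 <= c ->
  (forall e, 0 < e ->
     \forall n \near \oo, (count_below A n)%:R <= (c + e) * n%:R :> R) ->
  upper_density R A <= c.
Proof.
move=> c0 hA; apply/ler_addgt0Pr => e e0.
rewrite /upper_density limn_supE; last exact: bounded_frequency.
have [N _ HN] := hA e e0.
apply: (@le_trans _ _ (sups (frequency R A) N)).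
  apply: ge_inf; last by exists N.
  exact/bounded_fun_has_lbound_sups/bounded_frequency.
apply: ge_sup; first by exists (frequency R A N), N => /=.
move=> _ [n /= Nn <-]; apply: frequency_le; last exact: HN.
by rewrite addr_ge0// ltW.
Qed.

Lemma lower_density_le0 A :
  (forall e N, 0 < e ->
     exists2 n, (N <= n)%N & (count_below A n)%:R <= e * n%:R :> R) ->
  lower_density R A <= 0.
Proof.
move=> hA; rewrite /lower_density limn_infE; last exact: bounded_frequency.
apply: ge_sup; first by exists (infs (frequency R A) 0%N), 0%N.
move=> _ [N _ <-]; apply/ler_addgt0Pr => e e0; rewrite add0r.
have [n Nn An] := hA e N e0.
apply: (@le_trans _ _ (frequency R A n)).
  apply: ge_inf; last by exists n.
  by exists 0 => _ [k _ <-]; exact: frequency_ge0.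
by apply: frequency_le => //; exact: ltW.
Qed.

(** That is, [b = o(n)] when [b ^ 2 <= n]: by the arithmetic-geometric mean
    inequality, [2 b <= e b^2 + 1/e], and [1/e <= e n] for large [n]. *)
Lemma sublinear_of_square (e : R) : 0 < e ->
  \forall n \near \oo, forall b, (b ^ 2 <= n)%N -> b%:R <= e * n%:R.
Proof.
move=> e0; near=> n => b bn.
have en : e^-1 <= e * n%:R.
  rewrite -ler_pdivrMl//; near: n; exact: nbhs_infty_ger.
have bn' : b%:R ^+ 2 <= n%:R :> R by rewrite -natrX ler_nat.
have amgm : 2 * b%:R <= e * b%:R ^+ 2 + e^-1.
  have -> : e * b%:R ^+ 2 + e^-1 = e * (b%:R - e^-1) ^+ 2 + 2 * b%:R.
    by field; rewrite gt_eqF.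
  by rewrite lerDr mulr_ge0 ?sqr_ge0// ltW.
have : e * b%:R ^+ 2 <= e * n%:R by rewrite ler_pM2l.
by lra.
Unshelve. all: by end_near. Qed.

End Density.

(** * Alternating two colours in growing blocks *)

(** The quadratic growth makes the block boundaries a set of density zero. *)
Definition block_starts (a : nat -> nat) : Prop :=
  [/\ a 0 = 0%N, forall k, (a k < a k.+1)%N & forall k, (k ^ 2 <= a k)%N].

Section Blocks.
Variable a : nat -> nat.

(** The index of the block containing [n], the [k]-th block being the interval
    from [a k] to [a k.+1]. As [a] is strictly increasing, at most one block
    starts at each step, so that testing the next start is enough. *)
Fixpoint block (n : nat) : nat :=
  if n is p.+1 then
    if (a (block p).+1 <= n)%N then (block p).+1 else block p
  else 0%N.

Lemma blockS n : block n.+1 =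
  if (a (block n).+1 <= n.+1)%N then (block n).+1 else block n.
Proof. by []. Qed.

Definition colour (b : bool) : set nat := [set i | odd (block i) = b].

Lemma in_colour b i : (i \in colour b) = (odd (block i) == b).
Proof. by apply/idP/eqP; rewrite inE. Qed.

Lemma not_colour b i : ~ colour b i -> colour (~~ b) i.
Proof. by rewrite /colour /=; case: odd; case: b. Qed.

Hypothesis starts_a : block_starts a.

Lemma blockP n : (a (block n) <= n < a (block n).+1)%N.
Proof.
case: starts_a => a0 aS _.
elim: n => [|n /andP[IH1 IH2]]; first by rewrite /= a0 leqnn -{1}a0 aS.
rewrite blockS; have [le_a|lt_a] := leqP (a (block n).+1) n.+1.
  by rewrite le_a (leq_ltn_trans IH2) ?aS.
by rewrite lt_a leqW.
Qed.

Lemma leq_block k n : (a k <= n)%N = (k <= block n)%N.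
Proof.
have [_ aS _] := starts_a.
have aM : {homo a : i j / (i <= j)%N}.
  by apply: homo_leq => // [i j l|i]; [exact: leq_trans|exact: ltnW].
have /andP[h1 h2] := blockP n.
have [kb|bk] := leqP k (block n); first exact: leq_trans (aM _ _ kb) h1.
apply/negbTE; rewrite -ltnNge; exact: leq_trans h2 (aM _ _ bk).
Qed.

(** Each switch increments the block index. *)
Lemma count_switches n :
  (count_below [set i | odd (block i) != odd (block i.+1)] n <= block n)%N.
Proof.
elim: n => [|n IHn]; first by rewrite /count_below big_ord0.
rewrite count_belowS.
have -> : (n \in [set i | odd (block i) != odd (block i.+1)]) =
    (odd (block n) != odd (block n.+1)) by apply/idP/idP; rewrite inE.
move: IHn; rewrite blockS; case: ifP => _; rewrite ?eqxx/=; lia.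
Qed.

(** All the times of colour [b] below [n] precede the current block, which has
    the other colour. *)
Lemma count_colour_off b n : odd (block n) != b ->
  (count_below (colour b) n <= a (block n))%N.
Proof.
elim: n => [|n IHn]; first by rewrite /count_below big_ord0.
rewrite count_belowS in_colour blockS.
have := count_below_le (colour b) n.
case: ifP => [h|h]; rewrite /= => ?.
  have /andP[_] := blockP n.
  by move: (nat_of_bool _) (leq_b1 (odd (block n) == b)); lia.
by move=> hb; rewrite (negbTE hb) addn0; exact: IHn.
Qed.

Lemma frequency_switches_cvg0 {R : realType} :
  frequency R [set i | odd (block i) != odd (block i.+1)] @ \oo --> (0 : R).
Proof.
have [_ _ aq] := starts_a.
apply/cvgrPdist_le => e e0.
have := sublinear_of_square e0; apply: filterS => n small.
rewrite sub0r normrN ger0_norm ?frequency_ge0//.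
apply: frequency_le; first exact: ltW.
apply: (@le_trans _ _ (block n)%:R); first by rewrite ler_nat count_switches.
by apply: small; have /andP[+ _] := blockP n; exact: leq_trans.
Qed.

End Blocks.

(** * Equal shares: blocks between squares *)

Section Squares.
Let sq k := (k ^ 2)%N.

Lemma block_starts_squares : block_starts sq.
Proof. by split=> // k; rewrite ltn_exp2r. Qed.

(** The lengths of consecutive blocks differ by two only, so at the start of
    block [k] the two colours have a surplus of [k] over one another, and the
    twofold count of a colour is [k ^ 2 + k] or [k ^ 2 - k]. Hence each count is
    [n / 2] up to an error of order [k], that is of order the square root of
    [n]. *)
Lemma count_colour_squares b n : let k := block sq n in
  (count_below (colour sq b) n).*2 =
  if odd k == b then (n.*2 - (k ^ 2 + k))%N else (k ^ 2 + k)%N.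
Proof.
elim: n => [|n IH] k; first by rewrite /k /count_below big_ord0; case: b.
rewrite {}/k count_belowS doubleD in_colour blockS.
have := blockP block_starts_squares n.
move: IH; rewrite /sq; move: (block _ n) (count_below _ _) => k c /=.
rewrite !expnS !expn0 !muln1 => IH /andP[h1 h2].
have [hk|hk] := leqP (k.+1 * k.+1)%N n.+1;
  move: IH => /=; case: b; case: (odd k); rewrite /=; nia.
Qed.

(** Otherwise [S] would eventually lie in the other colour, which has density
    one half. *)
Lemma upper_dense_meets_colours {R : realType} (S : set nat) b N :
  1 / 2 < upper_density R S ->
  exists2 i, (N <= i)%N & S i /\ colour sq b i.
Proof.
move=> Sbig; apply: contrapT => /forall2NP noS; move: Sbig; apply/negP.
rewrite -leNgt; apply: upper_density_le; first by rewrite divr_ge0.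
move=> e e0; have e2 : 0 < e / 2 by rewrite divr_gt0.
near=> n.
have hN : N%:R <= e / 2 * n%:R.
  by rewrite mulrC -ler_pdivrMr//; near: n; exact: nbhs_infty_ger.
have hS : (count_below S n <= N + count_below (colour sq (~~ b)) n)%N.
  apply: count_below_sub => i Ni Si; apply: not_colour => ci.
  by have [//|] := noS i; apply.
have /andP[sqk sqk1] := blockP block_starts_squares n.
have hk : (block sq n)%:R <= e * n%:R.
  by move: (block sq n) sqk; near: n; exact: sublinear_of_square.
have hc : ((count_below (colour sq (~~ b)) n).*2 <= n + block sq n)%N.
  rewrite count_colour_squares; move: sqk sqk1; rewrite /sq !expnS !expn0.
  by move: (block _ n) => k; case: ifP => _; nia.
have hS2 : ((count_below S n).*2 <= N.*2 + (n + block sq n))%N.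
  by rewrite (leq_trans _ (leq_add (leqnn _) hc))// -doubleD leq_double.
move: hS2; rewrite -(ler_nat R) !natrD -!mul2n !natrM.
by lra.
Unshelve. all: by end_near. Qed.

End Squares.

(** * Dominating blocks: starts at k k! *)

Section Factorials.
Let fa k := (k * k`!)%N.

Let faS k : (fa k < fa k.+1)%N.
Proof. by rewrite /fa factS; have := fact_gt0 k; nia. Qed.

Let fa_ge k : (k ^ 2 <= fa k)%N.
Proof.
rewrite /fa expnS expn1 leq_mul2l; case: k => // k.
by rewrite factS leq_pmulr ?fact_gt0 ?orbT.
Qed.

Lemma block_starts_factorials : block_starts fa.
Proof. by split. Qed.

Let fa_growth k : (k * fa k + fa k <= fa k.+1)%N.
Proof. by rewrite /fa factS; nia. Qed.

(** Otherwise [S] would eventually lie in the other colour, of which there is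
    only a share of order [1/k] below the end of a block [k] of colour [b]. *)
Lemma lower_dense_meets_colours {R : realType} (S : set nat) b N :
  0 < lower_density R S ->
  exists2 i, (N <= i)%N & S i /\ colour fa b i.
Proof.
move=> Sbig; apply: contrapT => /forall2NP noS; move: Sbig; apply/negP.
rewrite -leNgt; apply: lower_density_le0 => e N0 e0.
have [K hK] : exists K, (N.+1)%:R <= e * K%:R.
  have [K _ hK] : \forall K \near \oo, (N.+1)%:R / e <= K%:R :> R.
    exact: nbhs_infty_ger.
  by exists K; rewrite mulrC -ler_pdivrMr//; exact: hK (leqnn K).
(* the end of a block [k] of colour [b], so late that all earlier blocks
   together are negligible *)
pose k := (b + (K + N0).+1.*2)%N.
have kb : odd k = b by rewrite /k oddD odd_double addbF; case: (b).
pose n := (fa k.+1).-1.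
have [fak fak1] := (fa_growth k, faS k).
have nk : block fa n = k.
  apply/eqP; rewrite eqn_leq -(leq_block block_starts_factorials) leqNgt.
  by rewrite -(leq_block block_starts_factorials) /n; move: fak1; lia.
have kgt : (K + N0 < k)%N by rewrite /k; lia.
have fak_gt0 : (K + N0 < fa k)%N.
  by apply: leq_trans (fa_ge k); rewrite expnS expn1; nia.
exists n; first by rewrite /n; lia.
have hS : (count_below S n <= N + count_below (colour fa (~~ b)) n)%N.
  apply: count_below_sub => i Ni Si; apply: not_colour => ci.
  by have [//|] := noS i; apply.
have hc : (count_below (colour fa (~~ b)) n <= fa k)%N.
  rewrite -nk; apply: (count_colour_off block_starts_factorials).
  by rewrite nk kb; case: (b).
have hSn : (count_below S n <= N.+1 * fa k)%N.
  by rewrite (leq_trans hS)// mulSn addnC leq_add// leq_pmulr; lia.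
have hn : (K * fa k <= n)%N by rewrite /n; nia.
apply: (@le_trans _ _ (N.+1%:R * (fa k)%:R)); first by rewrite -natrM ler_nat.
apply: (@le_trans _ _ (e * (K * fa k)%:R)).
  by rewrite natrM mulrA ler_wpM2r.
by rewrite ler_pM2l// ler_nat.
Qed.

End Factorials.

(** * Shadowing two orbits at once *)

Section TwoOrbits.
Context {R : realType} {X : metricType R} (f : X -> X).

(** Away from the switches the sequence follows a true orbit. *)
Lemma alternating_pseudo_orbit (a : nat -> nat) (w : bool -> X) (delta : R) :
  block_starts a -> 0 < delta ->
  ergodic_pseudo_orbit f delta (fun i => iter i f (w (odd (block a i)))).
Proof.
move=> starts_a delta0.
apply: (squeeze_cvgr _ (cvg_cst 0) (frequency_switches_cvg0 starts_a)).
apply: nearW => n; rewrite frequency_ge0/= !frequencyE ler_wpM2r// ler_nat.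
rewrite -[leqRHS]add0n; apply: count_below_sub => i _ /=.
by apply: contraTneq => <-; rewrite mdistxx -ltNge.
Qed.

(** Times beyond every [N] are needed for both orbits: a visit near one orbit has
    to come long after a visit near the other. *)
Lemma shadow_two_orbits (eps : R) (w : bool -> X) : 0 < eps ->
  upper_density_shadowing f \/ lower_density_shadowing f ->
  exists z, forall b N, exists2 i, (N <= i)%N &
    mdist (iter i f z) (iter i f (w b)) < eps.
Proof.
move=> eps0 [] /(_ _ eps0)[delta delta0 sh].
- have /sh[z zS] : ergodic_pseudo_orbit f delta
      (fun i => iter i f (w (odd (block (fun k => k ^ 2)%N i)))).
    exact: alternating_pseudo_orbit block_starts_squares delta0.
  exists z => b N; have [i Ni [Si ib]] := upper_dense_meets_colours b N zS.
  by exists i => //; rewrite -ib.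
- have /sh[z zS] : ergodic_pseudo_orbit f delta
      (fun i => iter i f (w (odd (block (fun k => k * k`!)%N i)))).
    exact: alternating_pseudo_orbit block_starts_factorials delta0.
  exists z => b N; have [i Ni [Si ib]] := lower_dense_meets_colours b N zS.
  by exists i => //; rewrite -ib.
Qed.

End TwoOrbits.

(** * Shadowing an orbit forces visits *)

Section UniformContinuity.
Context {R : realType} {X : metricType R}.
Hypothesis kX : compact [set: X].

(** Heine-Cantor theorem: a radius [r / 2] works near each point [x], and
    compactness provides a common one. *)
Lemma compact_unif_continuous (g : X -> X) (e : R) : continuous g -> 0 < e ->
  exists2 d, 0 < d & forall x y, ball x d y -> ball (g x) e (g y).
Proof.
move=> cg e0.
have [d [d0 gd]] : exists d, 0 < d /\
    [set: X] `<=` [set x | forall y, ball x d y -> ball (g x) e (g y)].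
  have e2 : 0 < e / 2 by rewrite divr_gt0.
  suff : \forall d \near (0 : R)^'+,
      [set: X] `<=` [set x | forall y, ball x d y -> ball (g x) e (g y)].
    move=> H; near (0 : R)^'+ => d; exists d; split=> //.
    by near: d.
  move/compact_near_coveringP : kX; apply => x _.
  have /nbhs_ballP[r /= r0 gr] : nbhs x (g @^-1` ball (g x) (e / 2)).
    by apply: cg; exact: nbhsx_ballx.
  have r2 : 0 < r / 2 by rewrite divr_gt0.
  exists (ball x (r / 2), [set d | d < r / 2]) => /=.
    by split; [exact: nbhsx_ballx | exact: nbhs_right_lt].
  move=> [x' d] [/= xx' dr] y x'y.
  apply: (@ball_splitr _ _ (g x)); apply: gr.
    by apply: le_ball xx'; lra.
  apply: (@ball_split _ _ x') => //.
  exact: le_ball (ltW dr) _ x'y.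
by exists d => // x y; exact: gd.
Unshelve. all: by end_near. Qed.

Lemma compact_unif_continuous_iter (f : X -> X) (L : nat) (e : R) :
  continuous f -> 0 < e ->
  exists2 d, 0 < d & forall x y l, (l <= L)%N ->
    ball x d y -> ball (iter l f x) e (iter l f y).
Proof.
move=> cf e0; elim: L => [|L [d d0 IHd]].
  by exists e => // x y l; rewrite leqn0 => /eqP ->.
have [d' d'0 Hd'] := compact_unif_continuous (@continuous_iter _ f L.+1 cf) e0.
exists (Num.min d d') => [|x y l]; first by rewrite lt_min d0.
rewrite leq_eqVlt => /predU1P[->|lL] xy.
  by apply: Hd'; apply: le_ball xy; rewrite ge_min lexx orbT.
by apply: IHd => //; apply: le_ball xy; rewrite ge_min lexx.
Qed.

End UniformContinuity.

Section Tracking.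
Context {R : realType} {X : metricType R} (f : X -> X).
Hypotheses (kX : compact [set: X]) (cf : continuous f).
Hypothesis dmin : dense (minimal_point f).

(** The bounds [eps] and [L] do not depend on the time [i] at which [z] is close
    to the orbit of [w]: that orbit is in a smaller ball inside [U] at a multiple
    of [m] at most [L] steps after [i], and [eps] is chosen by uniform continuity
    of the iterates of [f] up to the [L]-th. *)
Lemma orbit_forcing_visits m (U : set X) : (0 < m)%N -> open U -> U !=set0 ->
  exists w (eps : R) L, 0 < eps /\
    forall z i, mdist (iter i f z) (iter i f w) < eps ->
      exists2 t, (i <= m * t <= i + L)%N & U (iter t (iter m f) z).
Proof.
move=> m0 oU [c Uc].
have /nbhs_ballP[r /= r0 rU] : nbhs c U by exact: open_nbhs_nbhs.
have r2 : 0 < r / 2 by rewrite divr_gt0.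
have oW := open_interior (ball c (r / 2)).
have [|w [k k0 wk]] := syndetic_visits_iter kX cf dmin m oW.
  by exists c; exact: nbhsx_ballx.
(* at most [m] steps to a multiple of [m], then at most [k] further multiples *)
pose L := (m * k.+1)%N.
have [eps eps0 unif] := compact_unif_continuous_iter kX L cf r2.
exists w, eps, L; split=> // z i zw.
have [t [/= /interior_subset Wt /andP[/= it ti]]] := wk (i %/ m).+1.
have imt : (i <= m * t)%N.
  by rewrite (leq_trans (ltnW (ltn_ceil i m0)))// mulnC leq_mul2l it orbT.
have tiL : (m * t <= i + L)%N.
  have := leq_trunc_div i m; rewrite /L; nia.
exists t; first by rewrite imt.
apply: rU; apply: (ball_split Wt); apply: ball_sym.
rewrite !iterM -(subnK imt) !iterD; apply: unif; first by rewrite leq_subLR.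
by rewrite ballEmdist.
Qed.

End Tracking.

(** * Total syndetic transitivity *)

Theorem theorem7p2 (R : realType) (X : metricType R) (f : X -> X)
  (hX : compact [set: X]) (hf : continuous f)
  (hmin : dense (minimal_point f))
  (hsh : upper_density_shadowing f \/ lower_density_shadowing f) :
  totally_syndetically_transitive f.
Proof.
move=> m m0 U V oU oV U0 V0; apply: syndetic_hitting_times => //.
have [u [eu [Lu [eu0 hu]]]] := orbit_forcing_visits hX hf hmin m0 oU U0.
have [v [ev [Lv [ev0 hv]]]] := orbit_forcing_visits hX hf hmin m0 oV V0.
have e0 : 0 < Num.min eu ev by rewrite lt_min eu0.
have [z hz] := shadow_two_orbits (fun b : bool => if b then v else u) e0 hsh.
have [i _] := hz false 0%N.
rewrite lt_min => /andP[/hu[s /andP[_ si] Us] _].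
have [j ij] := hz true (i + Lu)%N.
rewrite lt_min => /andP[_ /hv[t /andP[jt _] Vt]].
have st : (s <= t)%N.
  by rewrite -(leq_pmul2l m0) (leq_trans si)// (leq_trans ij).
exists (t - s)%N, (iter t (iter m f) z); split=> //.
exists (iter s (iter m f) z) => //.
by rewrite -iterD subnK.
Qed.
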